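(* Consider a finite MDP $\langle\mathcal S,\mathcal A,(\mathcal A(s),s\in\mathcal S),P,r\rangle$ such that the Markov chain under every randomized stationary policy $u\in\mathcal U^{\rm RS}$ is ergodic (irreducible and aperiodic), and let $\alpha\in(0,1]$. (a) Define $$\lambda^*:=\min_{\lambda\in\Lambda}\Big\{\lambda:\ \min_{u\in\mathcal U^{\rm DS}}F^u(\lambda)\ge\alpha\Big\}.$$ Then the optimal value of the steady-state VaR maximization MDP, $\mathrm{VaR}^*:=\sup_{u\in\mathcal U^{\rm RS}}\mathrm{VaR}^u$, equals $\lambda^*$, i.e. $\mathrm{VaR}^*=\lambda^*$. (b) Let $\lambda^*_-(\Lambda)$ be the left predecessor of $\lambda^*$ in $\Lambda$, and suppose $u^*\in\mathcal U^{\rm DS}$ is optimal for the probabilistic minimization problem with target $\lambda^*_-(\Lambda)$, i.e. $F^{u^*}(\lambda^*_-(\Lambda))=\inf_{u\in\mathcal U^{\rm RS}}F^u(\lambda^*_-(\Lambda))$. Then $u^*$ is also optimal for the steady-state VaR maximization MDP, i.e. $\mathrm{VaR}^{u^*}=\mathrm{VaR}^*$.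
   Context: MDP: $\mathcal S$ and $\mathcal A$ are finite sets; $\mathcal A(s)\subseteq\mathcal A$ is the nonempty set of admissible actions in $s$, with $\cup_s\mathcal A(s)=\mathcal A$; $\mathcal K:=\{(s,a):s\in\mathcal S,a\in\mathcal A(s)\}$; $P(\cdot|s,a)$ is a probability distribution on $\mathcal S$ for each $(s,a)\in\mathcal K$; $r:\mathcal K\to\mathbb R$ is the reward function. Policies: $\mathcal U^{\rm RS}$ is the set of randomized stationary policies, i.e. maps $s\mapsto u(\cdot|s)$ with $u(\cdot|s)$ a probability distribution on $\mathcal A(s)$; $\mathcal U^{\rm DS}$ is the subset of deterministic ones (maps $u:\mathcal S\to\mathcal A$ with $u(s)\in\mathcal A(s)$). Under $u$, the state process is a Markov chain on $\mathcal S$ with transition matrix $\sum_{a}u(a|s)P(s'|s,a)$, and $\pi^u(s,a):=\lim_{t\to\infty}\mathbb P^u_{s_0}(s_t=s,a_t=a)$, which by ergodicity exists and does not depend on $s_0$. Steady-state quantities: $R^u_\infty$ is the random variable $r(s,a)$ with $(s,a)\sim\pi^u$; $\Lambda:=\{r(s,a):(s,a)\in\mathcal K\}$; for $\lambda\in\mathbb R$, $F^u(\lambda):=\mathbb P(R^u_\infty\le\lambda)=\sum_{(s,a)\in\mathcal K:\,r(s,a)\le\lambda}\pi^u(s,a)$; $\mathrm{VaR}^u:=\inf\{\lambda\in\mathbb R:F^u(\lambda)\ge\alpha\}$. Left predecessor of $\lambda\in\mathbb R$ in the finite set $\Lambda$: $\lambda_-(\Lambda):=\max\{y\in\Lambda:y<\lambda\}$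 if $\lambda>\min\Lambda$, and $\lambda_-(\Lambda):=\lambda-1$ if $\lambda\le\min\Lambda$. *)

(* Defs.v *)
From HB Require Import structures.
From mathcomp Require Import all_boot all_order all_algebra.
From mathcomp Require Import all_classical all_reals all_analysis.

Set Implicit Arguments.
Unset Strict Implicit.
Unset Printing Implicit Defensive.

Import Order.TTheory GRing.Theory Num.Theory.
Import numFieldNormedType.Exports.

Local Open Scope classical_set_scope.
Local Open Scope ring_scope.

(* The transition law and the reward are total functions of a state and an    *)
(* action; only their values on the admissible pairs are constrained, and all *)
(* notions below only depend on these values.                                 *)
Record mdp (R : realType) (S A : finType) := Mdp {
  adm : S -> {set A};
  trans_prob : S -> A -> S -> R;
  reward : S -> A -> R;
  mdp_states : (0 < #|S|)%N;
  adm_nonempty : forall s, exists a, a \in adm s;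
  adm_cover : forall a, exists s, a \in adm s;
  trans_ge0 : forall s a s', a \in adm s -> 0 <= trans_prob s a s';
  trans_sum1 : forall s a, a \in adm s -> \sum_(s' : S) trans_prob s a s' = 1 }.

Section Chains.
Context (R : realType) (S : finType) (Q : S -> S -> R).

Fixpoint nstep (n : nat) (s s' : S) : R :=
  if n is m.+1 then \sum_(z : S) Q s z * nstep m z s' else (s == s')%:R.

Definition irreducible_chain : Prop :=
  forall s s', exists n, 0 < nstep n s s'.

(* For every state s, the gcd of the return times {n >= 1 : Q^n(s,s) > 0} is  *)
(* 1, i.e. 1 is the only common divisor of these times.                       *)
Definition aperiodic_chain : Prop :=
  forall s (d : nat),
    (forall n, (0 < n)%N -> 0 < nstep n s s -> (d %| n)%N) -> d = 1%N.

Definition ergodic_chain : Prop := irreducible_chain /\ aperiodic_chain.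

End Chains.

Section Extrema.
Context (R : realType).
Implicit Types (E : set R) (x : R).

(* Attained extrema: [min_of E] is the least element of E if there is one     *)
(* (and unspecified otherwise); dually for [max_of].                          *)
Definition min_of E : R := get [set m | E m /\ lbound E m].
Definition max_of E : R := get [set m | E m /\ ubound E m].

Definition left_pred E x : R :=
  if min_of E < x then max_of [set y | E y /\ y < x] else x - 1.

End Extrema.

Section SteadyState.
Context (R : realType) (S A : finType) (M : mdp R S A).
Implicit Types (u : S -> A -> R) (d : S -> A) (s : S) (a : A).

(* [u s a] is the probability u(a|s) of choosing a in state s. *)
Definition RS : set (S -> A -> R) :=
  [set u | forall s,
     [/\ forall a, 0 <= u s a,
         forall a, a \notin adm M s -> u s a = 0
       & \sum_(a in adm M s) u s a = 1]].

Definition DS : set (S -> A) := [set d | forall s, d s \in adm M s].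

Definition det_policy d : S -> A -> R := fun s a => (d s == a)%:R.

Definition policy_chain u (s s' : S) : R :=
  \sum_(a in adm M s) u s a * trans_prob M s a s'.

(* Probability, under P^u_{s0}, of the trajectory h of the state-action       *)
(* process up to time t, where h i = (s_i, a_i) for i = 0, ..., t.            *)
Definition traj_prob u (s0 : S) (t : nat) (h : {ffun 'I_t.+1 -> S * A}) : R :=
  ((h ord0).1 == s0)%:R
  * \prod_(i < t.+1) u (h i).1 (h i).2
  * \prod_(i < t) (let: (s, a) := h (widen_ord (leqnSn t) i) in
                   trans_prob M s a (h (lift ord0 i)).1).

(* P^u_{s0}(s_t = s, a_t = a) *)
Definition prob_at u (s0 : S) (t : nat) s a : R :=
  \sum_(h : {ffun 'I_t.+1 -> S * A} | h ord_max == (s, a)) traj_prob u s0 h.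

(* pi^u(s,a): the common value, over all initial states s0, of the limits of  *)
(* P^u_{s0}(s_t = s, a_t = a) as t tends to infinity.                         *)
Definition steady u s a : R :=
  get [set l : R | forall s0, prob_at u s0 t s a @[t --> \oo] --> l].

Definition Lambda : set R :=
  [set x | exists s a, a \in adm M s /\ x = reward M s a].

Definition steady_cdf u (x : R) : R :=
  \sum_(p : S * A | (p.2 \in adm M p.1) && (reward M p.1 p.2 <= x))
     steady u p.1 p.2.

Definition VaR (alpha : R) u : R := inf [set x : R | alpha <= steady_cdf u x].

Definition VaR_opt (alpha : R) : R := sup [set VaR alpha u | u in RS].

Definition lambda_star (alpha : R) : R :=
  min_of [set x | Lambda x /\
                  alpha <= min_of [set steady_cdf (det_policy d) x | d in DS]].

End SteadyState.

Arguments det_policy {R S A} d s a.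

(* Main.v *)
(** Deterministic policies suffice to minimize F^u(x) over U^RS: if u is changed
    in a single state s so as to play there a fixed action a, the renewal
    structure at s shows that F^u(x) is a convex combination of the values
    F^{u_a}(x) so obtained, hence one of them is at most F^u(x);
    treating the states one after the other produces a
    deterministic policy doing at least as well as u.  Consequently
    F^u >= alpha at lambda^*, i.e. VaR^u <= lambda^*, for every u.  Minimality of
    lambda^* yields a deterministic d with F^d < alpha at the left predecessor
    of lambda^*; as cdfs only jump on Lambda, every policy with this property
    has VaR = lambda^*, and the policies of part (b) have it a fortiori. *)

Require Import Defs.
From HB Require Import structures.
From mathcomp Require Import all_boot all_order all_algebra.
From mathcomp Require Import all_classical all_reals all_analysis.
From mathcomp Require Import ring lra zify.
Import Order.TTheory GRing.Theory Num.Theory.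
Import numFieldNormedType.Exports.
Local Open Scope classical_set_scope.
Local Open Scope ring_scope.

Set Implicit Arguments.
Unset Strict Implicit.
Unset Printing Implicit Defensive.

(** * Convergence of finite ergodic chains *)

(** The least positive gap between two elements of [T] divides every positive element, so it is 1.
    Once [a] and [a + 1] lie in [T], any n = q a + r with r <= q equals (q - r) a + r (a + 1). *)
Lemma additive_set_eventually (T : pred nat) :
  T 0 -> (forall m n, T m -> T n -> T (m + n)%N) ->
  (forall d, (forall n, (0 < n)%N -> T n -> (d %| n)%N) -> d = 1%N) ->
  exists N, forall n, (N <= n)%N -> T n.
Proof.
move=> T0 TD Tgcd.
have TM k n : T n -> T (k * n)%N.
  move=> Tn; elim: k => [|k IHk]; first by rewrite mul0n.
  by rewrite mulSn; apply: TD.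
pose gap g := `[< (0 < g)%N /\ exists2 a, T a & T (a + g)%N >].
have exg : exists g, gap g.
  have : ~ forall n, (0 < n)%N -> T n -> (2 %| n)%N by move=> /Tgcd.
  move=> /existsNP[n /not_implyP[n0 /not_implyP[Tn _]]].
  exists n; apply/asboolP; split=> //; by exists 0.
case: (ex_minnP exg) => g /asboolP[g0 [a Ta Tag]] gmin.
have g1 : g = 1%N.
  apply: Tgcd => n n0 Tn.
  have [//|ndvd] := boolP (g %| n)%N; exfalso.
  have r0 : (0 < n %% g)%N by rewrite lt0n.
  have : gap (n %% g)%N.
    apply/asboolP; split=> //.
    (* With q = [n %/ g], the elements q (a + g) and n + q a differ by the remainder of [n] modulo
       [g], a smaller gap. *)
    exists (n %/ g * (a + g))%N; first exact: TM.
    have -> : (n %/ g * (a + g) + n %% g = n + n %/ g * a)%N.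
      by rewrite {3}(divn_eq n g) mulnDr [RHS]addnC addnA.
    by apply: TD => //; apply: TM.
  by move/gmin; rewrite leqNgt ltn_mod g0.
subst g; exists (a * a)%N => n.
case: (posnP a) => [a0 _|a0 an].
  by rewrite a0 add0n in Tag; rewrite -[n]muln1; apply: TM.
have qa : (n %% a <= n %/ a)%N.
  apply: (leq_trans (ltnW (ltn_pmod n a0))).
  by rewrite leq_divRL.
have -> : n = ((n %/ a - n %% a) * a + n %% a * (a + 1))%N.
  rewrite [LHS](divn_eq n a) mulnBl mulnDr muln1.
  have := leq_mul qa (leqnn a); lia.
by apply: TD; apply: TM.
Qed.

(** * Powers of a stochastic matrix *)

Section StochasticMatrix.
Context {R : realType} {S : finType} (Q : S -> S -> R).
Context (Q_ge0 : forall s z, 0 <= Q s z).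
Context (Q_sum1 : forall s, \sum_z Q s z = 1).

Lemma nstepD m n s z :
  nstep Q (m + n) s z = \sum_w nstep Q m s w * nstep Q n w z.
Proof.
elim: m s => [|m IHm] s /=.
  rewrite add0n (bigD1 s) //= eqxx mul1r big1 ?addr0 // => w ws.
  by rewrite eq_sym (negbTE ws) mul0r.
under eq_bigr do rewrite IHm mulr_sumr.
rewrite exchange_big /=; apply: eq_bigr => w _.
by rewrite mulr_suml; apply: eq_bigr => v _; rewrite mulrA.
Qed.

Lemma nstepSr n s z : nstep Q n.+1 s z = \sum_w nstep Q n s w * Q w z.
Proof.
rewrite -addn1 nstepD; apply: eq_bigr => w _; congr (_ * _) => /=.
rewrite (bigD1 z) //= eqxx mulr1 big1 ?addr0 // => v vz.
by rewrite (negbTE vz) mulr0.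
Qed.

Lemma nstep_ge0 n s z : 0 <= nstep Q n s z.
Proof.
elim: n s => [|n IHn] s /=; first exact: ler0n.
by apply: sumr_ge0 => w _; rewrite mulr_ge0.
Qed.

Lemma nstep_sum1 n s : \sum_z nstep Q n s z = 1.
Proof.
elim: n s => [|n IHn] s /=.
  rewrite (bigD1 s) //= eqxx big1 ?addr0 // => w ws.
  by rewrite eq_sym (negbTE ws).
rewrite exchange_big /= -[RHS](Q_sum1 s); apply: eq_bigr => w _.
by rewrite -mulr_sumr IHn mulr1.
Qed.

Lemma nstepD_gt0 m n s w z :
  0 < nstep Q m s w -> 0 < nstep Q n w z -> 0 < nstep Q (m + n) s z.
Proof.
move=> mw nw; rewrite nstepD (bigD1 w) //= ltr_pwDl ?mulr_gt0 //.
by apply: sumr_ge0 => v _; rewrite mulr_ge0 // nstep_ge0.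
Qed.

(** The return times to [s] eventually contain every integer; following them by a fixed path from
    [s] to [z] only delays the threshold, and finitely many pairs have a common threshold. *)
Lemma ergodic_nstep_gt0 : ergodic_chain Q ->
  exists n, forall s z, 0 < nstep Q n s z.
Proof.
move=> [irr aper].
have ev (p : S * S) : exists N, forall n, (N <= n)%N -> 0 < nstep Q n p.1 p.2.
  case: p => s z /=.
  have [|m n Tm Tn|d Td|N NP] :=
      @additive_set_eventually (fun n => 0 < nstep Q n s s).
  - by rewrite /= eqxx ltr01.
  - exact: (nstepD_gt0 Tm Tn).
  - exact: aper Td.
  have [k kP] := irr s z; exists (N + k)%N => n leN.
  rewrite -(subnK (leq_trans (leq_addl N k) leN)).
  by apply: (nstepD_gt0 _ kP); apply: NP; rewrite leq_subRL ?(leq_trans _ leN) ?leq_addl // addnC.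
have [N NP] := choice ev.
exists (\max_p N p)%N => s z.
exact: (NP (s, z) _ (leq_bigmax (s, z))).
Qed.

End StochasticMatrix.

(** * Contraction of the oscillation by averaging *)

Section Contraction.
Context {R : realType} {S : finType} (s0 : S).
Implicit Types (Q : S -> S -> R) (f : S -> R).

(** The seed [f s0] is itself a value of [f], so the fold is the true maximum; likewise for the
    minimum below. *)
Definition largest f := \big[Num.max/f s0]_z f z.
Definition smallest f := \big[Num.min/f s0]_z f z.

Lemma le_largest f z : f z <= largest f.
Proof. exact: le_bigmax. Qed.

Lemma smallest_le f z : smallest f <= f z.
Proof. exact: bigmin_le. Qed.

Lemma largest_le f x : (forall z, f z <= x) -> largest f <= x.
Proof. by move=> fx; apply: bigmax_le. Qed.

Lemma le_smallest f x : (forall z, x <= f z) -> x <= smallest f.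
Proof. by move=> fx; apply: le_bigmin. Qed.

Context (Q : S -> S -> R).
Context (Q_ge0 : forall s z, 0 <= Q s z).
Context (Q_sum1 : forall s, \sum_z Q s z = 1).

Lemma largest_average f : largest (fun s => \sum_z Q s z * f z) <= largest f.
Proof.
apply: largest_le => s; rewrite -[leRHS]mul1r -(Q_sum1 s) mulr_suml.
by apply: ler_sum => z _; rewrite ler_wpM2l // le_largest.
Qed.

Lemma smallest_average f : smallest f <= smallest (fun s => \sum_z Q s z * f z).
Proof.
apply: le_smallest => s; rewrite -[leLHS]mul1r -(Q_sum1 s) mulr_suml.
by apply: ler_sum => z _; rewrite ler_wpM2l // smallest_le.
Qed.

(** Doeblin minorization: each row puts weight at least [e] on a minimizer of [f], and the remaining
    weight meets values at most [largest f]. *)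
Lemma largest_contraction e f : 0 <= e -> (forall s z, e <= Q s z) ->
  largest (fun s => \sum_z Q s z * f z) <=
    largest f - e * (largest f - smallest f).
Proof.
move=> e0 eQ; apply: largest_le => s.
have le w : \sum_z Q s z * f z <= largest f - e * (largest f - f w).
  rewrite (bigD1 w) //=.
  have -> : largest f - e * (largest f - f w) =
            Q s w * f w + (largest f - e * (largest f - f w) - Q s w * f w).
    by rewrite [RHS]addrC subrK.
  rewrite lerD2l.
  have sumw : \sum_(z | z != w) Q s z = 1 - Q s w.
    by rewrite -(Q_sum1 s) [in RHS](bigD1 w) //= addrAC subrr add0r.
  apply: (@le_trans _ _ ((1 - Q s w) * largest f)).
    rewrite -sumw mulr_suml; apply: ler_sum => z _.
    by rewrite ler_wpM2l // le_largest.
  have := eQ s w; have := le_largest f w; nra.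
(* Solving [le w] for [f w], to bound [smallest f] from below, divides by [e]; hence the separate
   case. *)
have [->|e_neq0] := eqVneq e 0.
  by rewrite mul0r subr0; have := le s; have := le_largest f s; have := e0; nra.
have e_gt0 : 0 < e by rewrite lt_neqAle eq_sym e_neq0.
pose y := \sum_z Q s z * f z.
have : (y - largest f) / e + largest f <= smallest f.
  apply: le_smallest => w; rewrite -lerBrDr ler_pdivrMr //.
  have := le w; rewrite -/y; nra.
by rewrite -lerBrDr ler_pdivrMr // -/y; nra.
Qed.

End Contraction.

Lemma sequence_cvg_unique {R : realType} (u : R^nat) (x y : R) :
  u t @[t --> \oo] --> x -> u t @[t --> \oo] --> y -> x = y.
Proof. by move=> ux uy; apply: (cvg_unique _ ux uy); exact: norm_hausdorff. Qed.

(** * Limit law of an ergodic chain *)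

Section ErgodicTheorem.
Context {R : realType} {S : finType} (Q : S -> S -> R).
Context (Q_ge0 : forall s z, 0 <= Q s z).
Context (Q_sum1 : forall s, \sum_z Q s z = 1).
Context (Q_erg : ergodic_chain Q).

(** Over the starting states, the maximum decreases with [t] and the minimum increases. Contraction
    over [N] steps, with all [N]-step probabilities at least [e > 0], gives H <= H - e (H - L) for
    their limits, so H = L. *)
Lemma nstep_cvg z :
  exists l : R, forall s, nstep Q t s z @[t --> \oo] --> l.
Proof.
pose f t s := nstep Q t s z.
pose hi t := largest z (f t); pose lo t := smallest z (f t).
have lohi t : lo t <= hi t.
  exact: le_trans (smallest_le z (f t) z) (le_largest z (f t) z).
have hiS : {homo hi : n m / (n <= m)%N >-> m <= n}.
  by apply/nonincreasing_seqP => t; exact: (largest_average z Q_ge0 Q_sum1).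
have loS : {homo lo : n m / (n <= m)%N >-> n <= m}.
  by apply/nondecreasing_seqP => t; exact: (smallest_average z Q_ge0 Q_sum1).
have hi_cvg : cvgn hi.
  apply: nonincreasing_is_cvgn => //; exists 0 => _ [t _ <-].
  by apply: le_trans (le_largest z (f t) z); exact: nstep_ge0.
have lo_cvg : cvgn lo.
  apply: nondecreasing_is_cvgn => //; exists (hi 0%N) => _ [t _ <-].
  by apply: le_trans (lohi t) _; exact: hiS.
have [N N_gt0] := ergodic_nstep_gt0 Q_ge0 Q_erg.
pose e := \big[Num.min/1]_(p : S * S) nstep Q N p.1 p.2.
have e_gt0 : 0 < e by apply: lt_bigmin => // p _; exact: N_gt0.
have e_le s w : e <= nstep Q N s w by exact: (bigmin_le 1 (s, w) (fun p => nstep Q N p.1 p.2)).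
have contr t : hi (t + N)%N <= hi t - e * (hi t - lo t).
  rewrite /hi /lo; have -> : f (t + N)%N = (fun s => \sum_w nstep Q N s w * f t w).
    by apply/funext => s; rewrite /f addnC nstepD.
  apply: largest_contraction; [exact: nstep_ge0|exact: nstep_sum1|exact: ltW|exact: e_le].
set H := limn hi in hi_cvg *; set L := limn lo in lo_cvg *.
have hiN : hi (t + N)%N @[t --> \oo] --> H.
  by have := hi_cvg; rewrite -(cvg_shiftn N).
have rhs : hi t - e * (hi t - lo t) @[t --> \oo] --> H - e * (H - L).
  by apply: cvgB => //; apply: cvgM; [exact: cvg_cst|exact: cvgB].
have HL : H <= H - e * (H - L).
  by apply: (ler_cvg_to hiN rhs); apply: nearW.
have LH : L <= H by apply: (ler_cvg_to lo_cvg hi_cvg); apply: nearW.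
have {HL LH} eqHL : H = L.
  apply/le_anti; rewrite LH andbT; have := e_gt0; nra.
exists L => s; apply: (squeeze_cvgr _ lo_cvg).
  by apply: nearW => t; apply/andP; split;
    [exact: (smallest_le z (f t) s)|exact: (le_largest z (f t) s)].
by rewrite -eqHL.
Qed.

Lemma ergodic_theorem : exists mu : S -> R,
  forall s z, nstep Q t s z @[t --> \oo] --> mu z.
Proof.
by have [mu mu_cvg] := choice nstep_cvg; exists mu => s z; exact: mu_cvg.
Qed.

Context (mu : S -> R) (s0 : S).
Context (mu_cvg : forall s z, nstep Q t s z @[t --> \oo] --> mu z).

Let cvg_sumr (F : S -> R^nat) (l : S -> R) :
  (forall z, F z t @[t --> \oo] --> l z) ->
  \sum_z F z t @[t --> \oo] --> \sum_z l z.
Proof.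
by move=> Fl; apply: cvg_big => [|z _]; [exact: add_continuous|exact: Fl].
Qed.

Lemma invariant_nstep nu : (forall z, \sum_s nu s * Q s z = nu z) ->
  forall t z, \sum_s nu s * nstep Q t s z = nu z.
Proof.
move=> nuQ; elim=> [|t IHt] z.
  rewrite (bigD1 z) //= eqxx mulr1 big1 ?addr0 // => s sz.
  by rewrite (negbTE sz) mulr0.
under eq_bigr do rewrite nstepSr mulr_sumr.
rewrite exchange_big -[RHS]nuQ; apply: eq_bigr => w _.
by rewrite -(IHt w) mulr_suml; apply: eq_bigr => s _; rewrite mulrA.
Qed.

(** The product of [nu] with the t-th power is constant in [t]; its limit is the right-hand side.
    The total mass is kept as a factor since the measure built for derandomization is not
    normalized. *)
Lemma invariant_unique nu : (forall z, \sum_s nu s * Q s z = nu z) ->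
  forall z, nu z = (\sum_s nu s) * mu z.
Proof.
move=> nuQ z.
have : \sum_s nu s * nstep Q t s z @[t --> \oo] --> \sum_s nu s * mu z.
  by apply: cvg_sumr => s; apply: cvgM; [exact: cvg_cst|exact: mu_cvg].
rewrite mulr_suml => /sequence_cvg_unique lim; apply/esym/lim.
by under eq_fun do rewrite invariant_nstep //; exact: cvg_cst.
Qed.

Lemma invariant_limit z : \sum_s mu s * Q s z = mu z.
Proof.
have : \sum_s nstep Q t s0 s * Q s z @[t --> \oo] --> \sum_s mu s * Q s z.
  by apply: cvg_sumr => s; apply: cvgM; [exact: mu_cvg|exact: cvg_cst].
move=> /sequence_cvg_unique; apply.
under eq_fun do rewrite -nstepSr.
by have := @mu_cvg s0 z; rewrite -(cvg_shiftS (fun t => nstep Q t s0 z)).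
Qed.

Lemma limit_sum1 : \sum_s mu s = 1.
Proof.
have : \sum_s nstep Q t s0 s @[t --> \oo] --> \sum_s mu s.
  by apply: cvg_sumr => s; exact: mu_cvg.
move=> /sequence_cvg_unique; apply.
by under eq_fun do rewrite nstep_sum1 //; exact: cvg_cst.
Qed.

(** Some state has positive mass because the total is 1, and irreducibility with invariance carries
    mass from it to [z]. *)
Lemma limit_gt0 z : 0 < mu z.
Proof.
have mu_ge0 s : 0 <= mu s.
  by apply: (ler_cvg_to (cvg_cst 0) (@mu_cvg s0 s)); apply: nearW => t; exact: nstep_ge0.
have [w /= mw] : exists w, true && (0 < mu w).
  by apply: psumr_neq0P => //; rewrite limit_sum1; apply/eqP; exact: oner_neq0.
have [n Qn] := Q_erg.1 w z.
rewrite -(invariant_nstep invariant_limit n z) (bigD1 w) //= ltr_pwDl ?mulr_gt0 //.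
by apply: sumr_ge0 => s _; rewrite mulr_ge0 // nstep_ge0.
Qed.

End ErgodicTheorem.

(** * Steady state of a randomized stationary policy *)

Section Trajectories.
Context {R : realType} {S A : finType} (M : mdp R S A).
Context (u : S -> A -> R) (uRS : RS M u).

Lemma policy_chain_ge0 s z : 0 <= policy_chain M u s z.
Proof.
have [u_ge0 _ _] := uRS s.
by apply: sumr_ge0 => a sa; rewrite mulr_ge0 // trans_ge0.
Qed.

Lemma policy_chain_sum1 s : \sum_z policy_chain M u s z = 1.
Proof.
have [_ _ u_sum1] := uRS s.
rewrite exchange_big /= -[RHS]u_sum1; apply: eq_bigr => a sa.
by rewrite -mulr_sumr trans_sum1 // mulr1.
Qed.

(** Trajectories grow at the front, so that their sums split on the first step exactly as [nstep]
    does. *)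
Definition fcons (T : Type) t (p : T) (h : {ffun 'I_t -> T}) : {ffun 'I_t.+1 -> T} :=
  [ffun i => if unlift ord0 i is Some j then h j else p].

Lemma fcons0 (T : Type) t (p : T) (h : {ffun 'I_t -> T}) : fcons p h ord0 = p.
Proof. by rewrite ffunE unlift_none. Qed.

Lemma fconsS (T : Type) t (p : T) (h : {ffun 'I_t -> T}) i :
  fcons p h (lift ord0 i) = h i.
Proof. by rewrite ffunE liftK. Qed.

Lemma fcons_bij (T : Type) t :
  bijective (fun q : T * {ffun 'I_t -> T} => fcons q.1 q.2).
Proof.
exists (fun h : {ffun 'I_t.+1 -> T} => (h ord0, [ffun i => h (lift ord0 i)])).
  move=> [p h] /=; rewrite fcons0; congr pair.
  by apply/ffunP => i; rewrite ffunE fconsS.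
move=> h; apply/ffunP => i; rewrite ffunE /=.
by case: unliftP => [j|] ->; rewrite ?ffunE.
Qed.

Lemma prob_at0 s0 s a : prob_at M u s0 0 s a = (s0 == s)%:R * u s a.
Proof.
rewrite /prob_at (big_pred1 [ffun=> (s, a)]) => [|h]; last first.
  apply/eqP/eqP => [hsa|->]; last by rewrite ffunE.
  by apply/ffunP => i; rewrite ffunE -hsa; congr (h _); rewrite !ord1.
by rewrite /traj_prob big_ord0 big_ord1 !ffunE /= mulr1 eq_sym.
Qed.

Lemma prob_atS s0 t s a :
  prob_at M u s0 t.+1 s a = \sum_z policy_chain M u s0 z * prob_at M u z t s a.
Proof.
rewrite /prob_at.
under [RHS]eq_bigr do rewrite mulr_sumr.
rewrite exchange_big /= (reindex _ (onW_bij _ (@fcons_bij (S * A) t.+1))) /=.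
(* The trivial [true &&] gives the condition the product shape that [pair_big] expects. *)
rewrite (eq_bigl (fun q : (S * A) * {ffun 'I_t.+1 -> S * A} =>
  true && (q.2 ord_max == (s, a)))); last first.
  case=> p h /=; have -> : ord_max = lift ord0 ord_max :> 'I_t.+2 by apply: val_inj.
  by rewrite fconsS.
rewrite -(pair_big predT (fun h : {ffun _ -> S * A} => h ord_max == (s, a))
  (fun p h => traj_prob M u s0 (fcons p h))) exchange_big /=.
(* On the right, only the [z] where the trajectory [h] actually starts contributes. *)
apply: eq_bigr => h _; rewrite [RHS](bigD1 (h ord0).1) //= [X in _ + X]big1 ?addr0; last first.
  by move=> z zh; rewrite /traj_prob eq_sym (negbTE zh) !mul0r mulr0.
pose rest := \prod_(i < t.+1) u (h i).1 (h i).2 *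
  \prod_(i < t) (let: (s, a) := h (widen_ord (leqnSn t) i) in
                 trans_prob M s a (h (lift ord0 i)).1).
have -> : traj_prob M u (h ord0).1 h = rest by rewrite /traj_prob eqxx mul1r.
have traj_cons p : traj_prob M u s0 (fcons p h) =
    (p.1 == s0)%:R * (u p.1 p.2 * trans_prob M p.1 p.2 (h ord0).1) * rest.
  rewrite /traj_prob /rest fcons0 big_ord_recl fcons0.
  under eq_bigr do rewrite fconsS.
  rewrite [X in _ * X]big_ord_recl fconsS.
  have -> : widen_ord (leqnSn t.+1) ord0 = ord0 by apply: val_inj.
  rewrite fcons0; case: p => z b /=.
  under [X in _ * (_ * X)]eq_bigr => i _.
    have -> : widen_ord (leqnSn t.+1) (lift ord0 i) = lift ord0 (widen_ord (leqnSn t) i).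
      exact: val_inj.
    rewrite !fconsS; over.
  ring.
under eq_bigr do rewrite traj_cons.
rewrite -mulr_suml; congr (_ * _).
rewrite -(pair_bigA _ (fun z b => (z == s0)%:R * (u z b * trans_prob M z b (h ord0).1))) /=.
rewrite (bigD1 s0) //= [X in _ + X]big1 ?addr0; last first.
  by move=> z zs; apply: big1 => b _; rewrite (negbTE zs) mul0r.
rewrite /policy_chain [RHS]big_mkcond; apply: eq_bigr => b _.
rewrite eqxx mul1r; case: ifPn => // sb.
by have [_ -> //] := uRS s0; rewrite mul0r.
Qed.

Lemma prob_atE s0 t s a :
  prob_at M u s0 t s a = nstep (policy_chain M u) t s0 s * u s a.
Proof.
elim: t s0 => [|t IHt] s0; first exact: prob_at0.
rewrite prob_atS /= mulr_suml; apply: eq_bigr => z _.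
by rewrite IHt mulrA.
Qed.

Context (erg : ergodic_chain (policy_chain M u)).

(** Replaces the limit defining [steady] by algebra: state and action factor through the unique
    stationary law, which is all that later arguments use. *)
Lemma steadyE : exists mu : S -> R,
  [/\ forall s a, steady M u s a = mu s * u s a,
      forall s, 0 < mu s, \sum_s mu s = 1,
      forall z, \sum_s mu s * policy_chain M u s z = mu z &
      forall nu, (forall z, \sum_s nu s * policy_chain M u s z = nu z) ->
        forall z, nu z = (\sum_s nu s) * mu z].
Proof.
have Q0 := policy_chain_ge0; have Q1 := policy_chain_sum1.
have /card_gt0P[s0 _] := mdp_states M.
have [mu mu_cvg] := ergodic_theorem Q0 Q1 erg.
have steady_cvg s a z : prob_at M u z t s a @[t --> \oo] --> mu s * u s a.
  under eq_fun do rewrite prob_atE.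
  by apply: cvgM; [exact: mu_cvg|exact: cvg_cst].
exists mu; split.
- move=> s a; apply: get_unique => [z|l /(_ s0) lP]; first exact: steady_cvg.
  exact: sequence_cvg_unique lP (steady_cvg _ _ _).
- by move=> s; exact: (limit_gt0 Q0 Q1 erg s0 mu_cvg).
- exact: (limit_sum1 Q1 s0 mu_cvg).
- exact: (invariant_limit s0 mu_cvg).
- exact: (invariant_unique mu_cvg).
Qed.

End Trajectories.

(** * Deterministic policies suffice *)

Section Derandomization.
Context {R : realType} {S A : finType} (M : mdp R S A).
Context (ergodic : forall u, RS M u -> ergodic_chain (policy_chain M u)).
Implicit Types (u : S -> A -> R) (k : S -> A -> R) (s : S) (a : A).

(** One notion for two uses: [k] is a column of transition probabilities, giving [policy_chain], or
    the indicator of a reward level, giving the cdf. *)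
Definition action_mean k u s := \sum_(a in adm M s) u s a * k s a.

Definition fix_action u s a : S -> A -> R :=
  fun z => if z == s then fun b => (b == a)%:R else u z.

Lemma action_mean_fix_action k u s a : a \in adm M s ->
  action_mean k (fix_action u s a) s = k s a.
Proof.
move=> sa; rewrite /action_mean /fix_action eqxx (bigD1 a) //= eqxx mul1r.
by rewrite big1 ?addr0 // => b /andP[_ /negbTE->]; rewrite mul0r.
Qed.

Lemma action_mean_fix_action_neq k u s a z : z != s ->
  action_mean k (fix_action u s a) z = action_mean k u z.
Proof. by move=> /negbTE zs; rewrite /action_mean /fix_action zs. Qed.

Lemma fix_action_RS u s a : RS M u -> a \in adm M s -> RS M (fix_action u s a).
Proof.
move=> uRS sa z; rewrite /fix_action; have [->|_] := eqVneq z s; last exact: uRS.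
split=> [b|b|]; first exact: ler0n.
- by apply: contraNeq; rewrite pnatr_eq0 eqb0 negbK => /eqP->.
- by rewrite (bigD1 a) //= eqxx big1 ?addr0 // => b /andP[_ /negbTE->].
Qed.

Lemma RS_sum1 u s : RS M u -> \sum_(a in adm M s) u s a = 1.
Proof. by case/(_ s). Qed.

Lemma steady_cdf_action_mean u x (mu : S -> R) :
  (forall s a, steady M u s a = mu s * u s a) ->
  steady_cdf M u x =
    \sum_s mu s * action_mean (fun s a => (reward M s a <= x)%R%:R) u s.
Proof.
move=> steady_mu; rewrite /steady_cdf /action_mean.
under [RHS]eq_bigr do rewrite mulr_sumr.
rewrite pair_big_dep /= [RHS]big_mkcond [LHS]big_mkcond /=.
apply: eq_bigr => -[s a] _ /=; rewrite steady_mu.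
by case: (a \in adm M s) => //=; case: ifP; rewrite ?mulr1 ?mulr0.
Qed.

(* With m a the stationary law of [fix_action u s a], the measure
   nu = \sum_a u(a|s) / m_a(s) m_a is invariant under u: between two visits to
   s all these policies coincide, and nu weighs the excursions from s by the
   law u(.|s) of the action opening them. *)
Lemma fix_action_improves u s x : RS M u -> exists2 a, a \in adm M s &
  steady_cdf M (fix_action u s a) x <= steady_cdf M u x.
Proof.
move=> uRS.
have [mu [steady_mu mu_gt0 mu_sum1 mu_inv mu_uniq]] := steadyE uRS (ergodic uRS).
have /choice[m mP] : forall a, exists ma : S -> R, a \in adm M s ->
    [/\ forall z b, steady M (fix_action u s a) z b = ma z * fix_action u s a z b,
        0 < ma s, \sum_z ma z = 1 &
        forall z, \sum_w ma w * policy_chain M (fix_action u s a) w z = ma z].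
  move=> a; case: (boolP (a \in adm M s)) => [sa|_]; last by exists (fun=> 0).
  have uaRS := fix_action_RS uRS sa.
  by have [ma [? ? ? ? _]] := steadyE uaRS (ergodic uaRS); exists ma.
(* Scaled so that [c a * m a s = u s a], hence [nu s = 1]. *)
pose c a := u s a / m a s.
pose nu z := \sum_(a in adm M s) c a * m a z.
have mean_nu k : \sum_z nu z * action_mean k u z =
    \sum_(a in adm M s) c a * \sum_z m a z * action_mean k (fix_action u s a) z.
  (* The two policies differ only at [s], where [c a * m a s = u s a]; the correction term sums to
     zero over the actions. *)
  have fixE a : a \in adm M s ->
      c a * (\sum_z m a z * action_mean k (fix_action u s a) z) =
      c a * (\sum_z m a z * action_mean k u z) +
      (u s a * k s a - u s a * action_mean k u s).
    move=> sa; have [_ ma_gt0 _ _] := mP a sa.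
    rewrite (bigD1 s) //= [in RHS](bigD1 s) //= action_mean_fix_action //.
    rewrite (eq_bigr (fun z => m a z * action_mean k u z)); last first.
      by move=> z zs; rewrite action_mean_fix_action_neq.
    by rewrite /c; field; exact: lt0r_neq0.
  rewrite (eq_bigr _ fixE) big_split /= sumrB -mulr_suml (RS_sum1 s uRS) mul1r subrr addr0.
  under eq_bigr do rewrite mulr_suml.
  rewrite exchange_big; apply: eq_bigr => a _; rewrite mulr_sumr.
  by apply: eq_bigr => z _; rewrite mulrA.
have nu_inv w : \sum_z nu z * policy_chain M u z w = nu w.
  rewrite (mean_nu (fun z b => trans_prob M z b w)).
  apply: eq_bigr => a sa; congr (_ * _).
  by have [_ _ _ <-] := mP a sa.
have nu_sum : \sum_z nu z = \sum_(a in adm M s) c a.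
  rewrite exchange_big; apply: eq_bigr => a sa.
  by have [_ _ ma_sum1 _] := mP a sa; rewrite -mulr_sumr ma_sum1 mulr1.
pose F a := steady_cdf M (fix_action u s a) x.
(* Uniqueness makes [nu] the multiple \sum_a c a of [mu], so the cdf of [u] is the [c]-weighted mean
   of the [F a]. *)
have mean_F : \sum_(a in adm M s) c a * (F a - steady_cdf M u x) = 0.
  under eq_bigr do rewrite mulrBr.
  rewrite sumrB -mulr_suml -nu_sum (steady_cdf_action_mean x steady_mu) mulr_sumr.
  apply/eqP; rewrite subr_eq0; apply/eqP.
  under [RHS]eq_bigr do rewrite mulrA -(mu_uniq nu nu_inv).
  rewrite mean_nu; apply: eq_bigr => a sa; have [steady_ma _ _ _] := mP a sa.
  by rewrite /F (steady_cdf_action_mean x steady_ma).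
apply: contrapT => /forall2NP worse.
have {}worse a : a \in adm M s -> steady_cdf M u x < F a.
  by move=> sa; have [//|/negP] := worse a; rewrite -ltNge.
have c_ge0 a : a \in adm M s -> 0 <= c a.
  have [u_ge0 _ _] := uRS s.
  by move=> sa; have [_ ma_gt0 _ _] := mP a sa; rewrite divr_ge0 // ltW.
(* If every [F a] were strictly larger, the vanishing sum of nonnegative terms would force each
   [c a], hence each [u s a], to be 0, although they sum to 1. *)
suff : (1 : R) = 0 by move/eqP; rewrite oner_eq0.
rewrite -(RS_sum1 s uRS) big1 // => a sa.
have [_ ma_gt0 _ _] := mP a sa.
move/eqP: mean_F; rewrite psumr_eq0 => [/allP/(_ a (mem_index_enum a))/implyP/(_ sa)|b sb].
  rewrite mulf_eq0 mulf_eq0 invr_eq0 subr_eq0 (gt_eqF (worse a sa)) orbF.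
  by rewrite (gt_eqF ma_gt0) orbF => /eqP.
by rewrite mulr_ge0 ?c_ge0 // subr_ge0 ltW // worse.
Qed.

Lemma deterministic_improves u x : RS M u -> exists2 d, DS M d &
  steady_cdf M (det_policy d) x <= steady_cdf M u x.
Proof.
move=> uRS.
(* Induction on the list of treated states: changing the policy at [s] preserves the choices already
   made at other states. *)
have [v [vRS v_det v_le]] : exists v, [/\ RS M v,
    forall s, s \in enum S -> exists2 a, a \in adm M s & v s = fun b => (b == a)%:R &
    steady_cdf M v x <= steady_cdf M u x].
  elim: (enum S) => [|s l [v [vRS v_det v_le]]]; first by exists u.
  have [a sa va_le] := fix_action_improves s x vRS.
  exists (fix_action v s a); split; [exact: fix_action_RS| |exact: le_trans v_le].
  move=> z; rewrite inE /fix_action; have [->|_] := eqVneq z s; first by exists a.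
  exact: v_det.
have /choice[d dP] : forall s, exists a, a \in adm M s /\ v s = fun b => (b == a)%:R.
  by move=> s; have [a] := v_det s (mem_enum _ _); exists a.
exists d; first by move=> s; have [] := dP s.
suff -> : det_policy d = v by [].
apply/funext => s; have [_ ->] := dP s; apply/funext => a.
by rewrite /det_policy eq_sym.
Qed.

Lemma det_policy_RS d : DS M d -> RS M (det_policy d).
Proof.
move=> dDS s; split=> [a|a|]; first exact: ler0n.
- by apply: contraNeq; rewrite pnatr_eq0 eqb0 negbK => /eqP<-; exact: dDS.
- rewrite (bigD1 (d s)) /=; last exact: dDS.
  rewrite /det_policy eqxx big1 ?addr0 // => a /andP[_].
  by rewrite eq_sym => /negbTE->.
Qed.

End Derandomization.

(** * Value at risk *)

Section FiniteExtrema.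
Context {R : realType}.
Implicit Types (E : set R).

(** The head of a sorted enumeration is least. The relation is a parameter so that its converse
    yields maxima. *)
Lemma finite_least (T : choiceType) (r : rel T) (E : set T) :
  total r -> transitive r -> finite_set E -> E !=set0 ->
  exists m, E m /\ forall x, E x -> r m x.
Proof.
move=> r_total r_trans /finite_seqP[l ->] [x /= xl].
have r_refl : reflexive r by move=> y; have := r_total y y; rewrite orbb.
case def_l : (sort r l) => [|m t]; first by rewrite -(mem_sort r) def_l in xl.
have := sort_sorted r_total l; rewrite def_l /= => /(order_path_min r_trans) min_m.
exists m; split=> [|y /=]; first by rewrite -(mem_sort r) def_l mem_head.
by rewrite -(mem_sort r) def_l inE => /orP[/eqP->//|/(allP min_m)].
Qed.

Lemma min_ofP E : finite_set E -> E !=set0 ->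
  E (min_of E) /\ lbound E (min_of E).
Proof.
move=> finE E0; apply: (@getPex _ [set m | E m /\ lbound E m]).
exact: (finite_least (@le_total _ R) (@le_trans _ R)).
Qed.

Lemma max_ofP E : finite_set E -> E !=set0 ->
  E (max_of E) /\ ubound E (max_of E).
Proof.
move=> finE E0; apply: (@getPex _ [set m | E m /\ ubound E m]).
apply: (@finite_least _ (fun x y => y <= x)) => // [x y|y x z xy yz].
  by rewrite le_total.
exact: le_trans yz xy.
Qed.

(** The element [y] itself witnesses that [x] exceeds the minimum of [E], so the default branch of
    [left_pred] is excluded. *)
Lemma left_pred_ge E x y : finite_set E -> E y -> y < x -> y <= left_pred E x.
Proof.
move=> finE Ey yx; have [_ minE] := min_ofP finE (ex_intro _ y Ey).
rewrite /left_pred (le_lt_trans (minE y Ey) yx).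
have [||_] := @max_ofP [set y | E y /\ y < x]; last exact.
  by apply: sub_finite_set finE => z [].
by exists y.
Qed.

End FiniteExtrema.

(** * Steady-state cdf, VaR and [lambda_star] *)

Section ValueAtRisk.
Context {R : realType} {S A : finType} (M : mdp R S A).
Context (ergodic : forall u, RS M u -> ergodic_chain (policy_chain M u)).
Implicit Types (u : S -> A -> R).

Lemma steady_ge0 u s a : RS M u -> 0 <= steady M u s a.
Proof.
move=> uRS; have [mu [-> mu_gt0 _ _ _]] := steadyE uRS (ergodic uRS).
by have [u_ge0 _ _] := uRS s; rewrite mulr_ge0 // ltW.
Qed.

(** The levels are compared only through attainable rewards, so [y] may even lie below [x] when no
    reward separates them: cdfs jump only on [Lambda]. *)
Lemma steady_cdf_le u x y : RS M u ->
  (forall z, Lambda M z -> z <= x -> z <= y) ->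
  steady_cdf M u x <= steady_cdf M u y.
Proof.
move=> uRS xy; rewrite /steady_cdf [leLHS]big_mkcond [leRHS]big_mkcond /=.
apply: ler_sum => -[s a] _ /=; have p0 := steady_ge0 s a uRS.
case: ifPn => [/andP[sa rx]|_]; last by case: ifP.
by rewrite sa xy //; exists s, a.
Qed.

Lemma steady_cdf_eq1 u x : RS M u ->
  (forall z, Lambda M z -> z <= x) -> steady_cdf M u x = 1.
Proof.
move=> uRS le_x; have [mu [mu_s _ mu1 _ _]] := steadyE uRS (ergodic uRS).
rewrite (steady_cdf_action_mean x mu_s) -[RHS]mu1; apply: eq_bigr => s _.
rewrite /action_mean -[RHS]mulr1 -[in RHS](RS_sum1 s uRS); congr (_ * _).
apply: eq_bigr => a sa; have -> : reward M s a <= x by apply: le_x; exists s, a.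
exact: mulr1.
Qed.

Lemma steady_cdf_eq0 u x : (forall z, Lambda M z -> x < z) -> steady_cdf M u x = 0.
Proof.
move=> lt_x; apply: big_pred0 => -[s a] /=; apply/negP => /andP[sa].
by apply/negP; rewrite -ltNge; apply: lt_x; exists s, a.
Qed.

Lemma Lambda_finite : finite_set (Lambda M).
Proof.
apply: (@sub_finite_set _ _ [set reward M p.1 p.2 | p in [set: S * A]]).
  by move=> _ [s [a [_ ->]]]; exists (s, a).
exact/finite_image/finite_finset.
Qed.

Lemma Lambda_neq0 : Lambda M !=set0.
Proof.
have /card_gt0P[s _] := mdp_states M; have [a sa] := adm_nonempty M s.
by exists (reward M s a), s, a.
Qed.

Lemma DS_neq0 : exists d, DS M d.
Proof. by have [d dP] := choice (adm_nonempty M); exists d. Qed.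

(** The minimum is attained because the values are covered by those of the finite type
    [{ffun S -> A}]. *)
Lemma min_DS_cdf x :
  let E := [set steady_cdf M (det_policy d) x | d in DS M] in
  E (min_of E) /\ lbound E (min_of E).
Proof.
apply: min_ofP; last by have [d dDS] := DS_neq0; exists (steady_cdf M (det_policy d) x), d.
apply: (@sub_finite_set _ _
  [set steady_cdf M (det_policy (f : S -> A)) x | f in [set: {ffun S -> A}]]).
  move=> _ [d _ <-]; exists (finfun d) => //; congr (steady_cdf M (det_policy _) x).
  by apply/funext => s; rewrite ffunE.
exact/finite_image/finite_finset.
Qed.

Context (alpha : R) (alpha_gt0 : 0 < alpha) (alpha_le1 : alpha <= 1).

(** Using [inf] requires a lower bound: below the least reward the cdf is 0, which is less than
    [alpha]. *)
Lemma VaR_le u x : alpha <= steady_cdf M u x -> VaR M alpha u <= x.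
Proof.
move=> ux; apply: ge_inf => //; exists (min_of (Lambda M)) => y /= uy.
have [_ minL] := min_ofP Lambda_finite Lambda_neq0.
rewrite leNgt; apply/negP => ylt; move: uy; rewrite leNgt steady_cdf_eq0 ?alpha_gt0 //.
by move=> z Lz; exact: lt_le_trans ylt (minL z Lz).
Qed.

(** Dually, the set under [inf] is nonempty, since the cdf is 1 >= [alpha] at the largest reward. *)
Lemma VaR_ge u x : RS M u -> (forall y, y < x -> steady_cdf M u y < alpha) ->
  x <= VaR M alpha u.
Proof.
move=> uRS ux; apply: lb_le_inf.
  have [_ maxL] := max_ofP Lambda_finite Lambda_neq0.
  by exists (max_of (Lambda M)) => /=; rewrite steady_cdf_eq1.
by move=> y /= uy; rewrite leNgt; apply/negP => /ux; rewrite ltNge uy.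
Qed.

Let x_star := lambda_star M alpha.

Lemma lambda_starP : [/\ Lambda M x_star,
  alpha <= min_of [set steady_cdf M (det_policy d) x_star | d in DS M] &
  forall y, Lambda M y ->
    alpha <= min_of [set steady_cdf M (det_policy d) y | d in DS M] -> x_star <= y].
Proof.
have [||[Ls le_s] min_s] := @min_ofP _ [set x | Lambda M x /\
    alpha <= min_of [set steady_cdf M (det_policy d) x | d in DS M]].
- by apply: sub_finite_set Lambda_finite => x [].
- have [Lmax maxL] := max_ofP Lambda_finite Lambda_neq0.
  (* At the largest reward every cdf equals 1, so this level is a candidate. *)
  exists (max_of (Lambda M)); split => //.
  have [[d dDS <-] _] := min_DS_cdf (max_of (Lambda M)).
  by rewrite steady_cdf_eq1 //; exact: det_policy_RS.
- by split=> // y Ly le_y; exact: min_s.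
Qed.

Lemma VaR_le_lambda_star u : RS M u -> VaR M alpha u <= x_star.
Proof.
move=> uRS; apply: VaR_le; have [_ le_s _] := lambda_starP.
have [d dDS] := deterministic_improves ergodic x_star uRS; apply: le_trans.
apply: le_trans le_s _; have [_] := min_DS_cdf x_star; apply.
by exists d.
Qed.

Lemma VaR_ge_lambda_star u : RS M u ->
  steady_cdf M u (left_pred (Lambda M) x_star) < alpha -> x_star <= VaR M alpha u.
Proof.
move=> uRS u_lt; apply: VaR_ge => // y y_lt; apply: le_lt_trans u_lt.
apply: steady_cdf_le => // z Lz zy.
by apply: left_pred_ge Lambda_finite Lz _; exact: le_lt_trans y_lt.
Qed.

Lemma cdf_left_pred_lt : exists2 d, DS M d &
  steady_cdf M (det_policy d) (left_pred (Lambda M) x_star) < alpha.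
Proof.
have [Ls _ min_s] := lambda_starP.
rewrite /left_pred; case: ifPn => [min_lt|]; last first.
  (* No reward lies below [x_star]; the default [x_star - 1] is below all rewards, and there every
     cdf is 0. *)
  rewrite -leNgt => s_le; have [d dDS] := DS_neq0; exists d => //.
  have [_ minL] := min_ofP Lambda_finite Lambda_neq0.
  rewrite steady_cdf_eq0 // => z Lz; rewrite ltrBlDr.
  by apply: (le_lt_trans (le_trans s_le (minL z Lz))); rewrite ltrDl.
have [||[Lp p_lt] _] := @max_ofP _ [set y | Lambda M y /\ y < x_star].
- by apply: sub_finite_set Lambda_finite => z [].
- by exists (min_of (Lambda M)); split=> //; have [] := min_ofP Lambda_finite Lambda_neq0.
set p := max_of _ in Lp p_lt *.
have [[d dDS dE] _] := min_DS_cdf p; exists d => //.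
(* Otherwise [p] would be a candidate smaller than [x_star]. *)
rewrite dE ltNge; apply/negP => /(min_s p Lp).
by rewrite leNgt p_lt.
Qed.

Lemma VaR_eq_lambda_star u : RS M u ->
  steady_cdf M u (left_pred (Lambda M) x_star) < alpha -> VaR M alpha u = x_star.
Proof.
move=> uRS u_lt; apply/le_anti.
by rewrite VaR_le_lambda_star // VaR_ge_lambda_star.
Qed.

(** The bound [x_star] is attained by a deterministic policy, so the supremum is a maximum. *)
Lemma VaR_opt_lambda_star : VaR_opt M alpha = x_star.
Proof.
have [d dDS d_lt] := cdf_left_pred_lt; have dRS := det_policy_RS (R := R) dDS.
have ub : ubound [set VaR M alpha u | u in RS M] x_star.
  by move=> _ [u uRS <-]; exact: VaR_le_lambda_star.
have mem : [set VaR M alpha u | u in RS M] x_star.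
  by exists (det_policy d) => //; exact: VaR_eq_lambda_star.
apply/le_anti/andP; split; first by apply: ge_sup => //; exists x_star.
by apply: ub_le_sup => //; exists x_star.
Qed.

End ValueAtRisk.

Unset Implicit Arguments.

Theorem theorem1 (R : realType) (S A : finType) (M : mdp R S A)
  (ergodic : forall u : S -> A -> R, RS M u -> ergodic_chain (policy_chain M u))
  (alpha : R) (alpha_gt0 : 0 < alpha) (alpha_le1 : alpha <= 1) :
  VaR_opt M alpha = lambda_star M alpha /\
  (forall ustar : S -> A, DS M ustar ->
     let x := left_pred (Lambda M) (lambda_star M alpha) in
     steady_cdf M (det_policy ustar) x = inf [set steady_cdf M u x | u in RS M] ->
     VaR M alpha (det_policy ustar) = VaR_opt M alpha).
Proof.
split; first exact: VaR_opt_lambda_star.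
move=> d dDS x d_opt; rewrite VaR_opt_lambda_star //.
apply: VaR_eq_lambda_star => //; first exact: det_policy_RS.
have [e eDS e_lt] := cdf_left_pred_lt ergodic alpha_gt0 alpha_le1.
(* The infimum over [RS], bounded below by 0, is at most the value of [e], which is already below
   [alpha]. *)
rewrite -/x d_opt; apply: le_lt_trans e_lt; apply: ge_inf.
  exists 0 => _ [u uRS <-]; apply: sumr_ge0 => p _.
  exact: (steady_ge0 ergodic).
by exists (det_policy e) => //; exact: det_policy_RS.
Qed.
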